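(* Let $A,B\in\mathbb{R}_{\max}^{m\times n}$ have no rows identically equal to $-\infty$ and no common column identically equal to $-\infty$. Then the spectral function $s(\lambda)$ of $(A,B)$ is a finite (i.e. real-valued) piecewise-affine Lipschitz function of $\lambda\in\mathbb{R}$.
   Context: $\mathbb{R}_{\max}=\mathbb{R}\cup\{-\infty\}$. For $A=(a_{ij})\in\mathbb{R}_{\max}^{m\times n}$ and $x\in\mathbb{R}_{\max}^n$, $(Ax)_i=\max_j(a_{ij}+x_j)$. For $y\in\mathbb{R}_{\max}^m$, $(A^{\sharp}y)_j=\min_{1\le i\le m}(-a_{ij}+y_i)$ with $(-\infty)+(+\infty)=+\infty$; $A^{\sharp}Bx$ means $A^{\sharp}(Bx)$; $\wedge$ is componentwise minimum. For an order-preserving, additively homogeneous map $f$ of $\mathbb{R}_{\max}^n$ to itself, continuous for the metric $\max_i|e^{x_i}-e^{y_i}|$, $r(f)=\max\{\lambda\in\mathbb{R}_{\max}\mid\exists x\in\mathbb{R}_{\max}^n,\ x\not\equiv-\infty,\ \lambda+x=f(x)\}$. For $\lambda\in\mathbb{R}$ let $h_\lambda(x)=(\lambda+A^{\sharp}Bx)\wedge(-\lambda+B^{\sharp}Ax)$; the spectral function is $s(\lambda):=r(h_\lambda)$. Piecewise-affine means composed of a finite number of affine pieces. *)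

(* Defs.v *)
From HB Require Import structures.
From mathcomp Require Import all_boot all_order all_algebra.
From mathcomp Require Import all_classical all_reals all_analysis.

Set Implicit Arguments.
Unset Strict Implicit.
Unset Printing Implicit Defensive.

Import Order.TTheory GRing.Theory Num.Theory.
Import numFieldNormedType.Exports.

Local Open Scope classical_set_scope.
Local Open Scope ring_scope.
Local Open Scope ereal_scope.

Section MaxPlus.
Context {R : realType}.

(* R_max is the part of \bar R avoiding +oo; matrices and vectors over R_max
   are matrices over \bar R satisfying [Rmax_mx]. The value +oo is needed for
   intermediate results: (A^# y)_j = +oo when column j of A is -oo. *)
Definition Rmax : set (\bar R) := [set x | x != +oo].

Definition Rmax_mx m n (A : 'M[\bar R]_(m, n)) : Prop :=
  forall i j, Rmax (A i j).

Definition mp_mul m n (A : 'M[\bar R]_(m, n)) (x : 'cV[\bar R]_n) :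
    'cV[\bar R]_m :=
  \col_i \big[maxe/-oo]_(j < n) (A i j + x j ord0).

(* The dual addition [%dE] is the one for which -oo + +oo = +oo. *)
Definition mp_residual m n (A : 'M[\bar R]_(m, n)) (y : 'cV[\bar R]_m) :
    'cV[\bar R]_n :=
  \col_j \big[mine/+oo]_(i < m) (- A i j + y i ord0)%dE.

Definition mp_shift n (c : \bar R) (x : 'cV[\bar R]_n) : 'cV[\bar R]_n :=
  map_mx (fun t => c + t) x.

Definition mp_meet n (x y : 'cV[\bar R]_n) : 'cV[\bar R]_n :=
  \col_j mine (x j ord0) (y j ord0).

Definition mp_eigenvalue n (f : 'cV[\bar R]_n -> 'cV[\bar R]_n) :
    set (\bar R) :=
  [set c | Rmax c /\ exists x : 'cV[\bar R]_n,
     [/\ Rmax_mx x, x != const_mx -oo & mp_shift c x = f x]].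

(* r(f) = c: the maximum is attained, hence c is an element of the set. *)
Definition is_spectral_radius n (f : 'cV[\bar R]_n -> 'cV[\bar R]_n)
    (c : \bar R) : Prop :=
  mp_eigenvalue f c /\ ubound (mp_eigenvalue f) c.

Definition h_map m n (A B : 'M[\bar R]_(m, n)) (lam : R)
    (x : 'cV[\bar R]_n) : 'cV[\bar R]_n :=
  mp_meet (mp_shift lam%:E (mp_residual A (mp_mul B x)))
          (mp_shift (- lam%:E) (mp_residual B (mp_mul A x))).

Definition is_spectral_function m n (A B : 'M[\bar R]_(m, n))
    (s : R -> \bar R) : Prop :=
  forall lam : R, is_spectral_radius (h_map A B lam) (s lam).

(* Intervals may be unbounded, open or closed, and may overlap; any finite
   cover by intervals can be refined to a finite partition into intervals. *)
Definition piecewise_affine (f : R -> R) : Prop :=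
  exists pieces : seq (interval R),
    (forall x : R, exists2 I, I \in pieces & x \in I) /\
    (forall I, I \in pieces ->
       exists a b : R, forall x : R, x \in I -> f x = (a * x + b)%R).

End MaxPlus.

(* Main.v *)
(** The map [h_lam] is a finite min-max function.  For [0 < a < 1] the equation
    [v = h_lam (a v)] has a real solution, namely the largest bounded [v] with
    [v <= h_lam (a v)].  Writing [x = v - max v], homogeneity turns it into
    [mu + x = h_lam (a x)] with [max x = 0], [mu] bounded and [mu] at least
    every [c] such that [c + y <= h_lam y] for some [y] not identically [-oo].
    Letting [a] tend to 1 along an ultrafilter gives an eigenvector for the
    limit of [mu], which is thus [s lam].
    Since [h_lam' >= h_lam - |lam - lam'|], the characterisation of [s lam] by
    subeigenvectors makes [s] nonexpansive.  Choosing at each coordinate of an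
    eigenvector a term attaining the minimum and the maximum, and following
    these choices around a cycle, exhibits [s lam] as the mean of the weights
    of that cycle: one of finitely many affine functions of [lam].  A
    continuous function which takes at each point the value of one of finitely
    many affine functions is piecewise affine. *)

Require Import Defs.
From HB Require Import structures.
From mathcomp Require Import all_boot all_order all_algebra.
From mathcomp Require Import all_classical all_reals all_analysis.
From mathcomp Require Import ring lra.

Set Implicit Arguments.
Unset Strict Implicit.
Unset Printing Implicit Defensive.

Import Order.TTheory GRing.Theory Num.Theory.
Import numFieldNormedType.Exports.

Local Open Scope classical_set_scope.
Local Open Scope ring_scope.
Local Open Scope ereal_scope.

(** * Limits in the extended reals along ultrafilters *)

Section UltraLimit.
Context {R : realType}.

(** Compactness of the extended reals: [contract] maps them into the compact segment [-1, 1], where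
    the image ultrafilter converges, and [expand] brings the limit back. *)
Lemma ultra_cvg_ereal {T : Type} (U : set_system T) (u : T -> \bar R) :
  UltraFilter U -> exists l : \bar R, u x @[x --> U] --> l.
Proof.
move=> UU.
have UF : ProperFilter U by exact: ultra_proper.
have FU : UltraFilter (contract (u x) @[x --> U]).
  apply: Build_UltraFilter => G GF sUG; apply/seteqP; split => // A GA.
  have [//|UnA] := in_ultra_setVsetC ((@contract R \o u) @^-1` A) UU.
  have GnA : G (~` A) by exact: sUG.
  by case: (@filter_not_empty _ G GF); rewrite -(setICr A); exact: filterI.
have := @segment_compact R (-1)%R 1%R; rewrite compact_ultra => /(_ _ FU) [].
  by apply: nearW => x /=; rewrite in_itv /= -ler_norml contract_le1.
move=> c [/=]; rewrite in_itv /= -ler_norml => c1 uc.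
(* The distance on [\bar R] is [|contract x - contract y|]. *)
exists (expand c); apply/cvg_ballP => e e0.
have /cvgrPdist_lt /(_ e e0) := uc.
by apply: filterS => x; rewrite /ball /= /ereal_ball expandK.
Qed.

Lemma cvge_max {T : Type} (F : set_system T) (FF : Filter F) (f g : T -> \bar R) (a b : \bar R) :
  f x @[x --> F] --> a -> g x @[x --> F] --> b ->
  maxe (f x) (g x) @[x --> F] --> maxe a b.
Proof.
move=> fa gb.
by apply: (cvg_comp2 fa gb); exact: (@max_continuous _ (\bar R) (a, b)).
Qed.

Lemma cvge_min {T : Type} (F : set_system T) (FF : Filter F) (f g : T -> \bar R) (a b : \bar R) :
  f x @[x --> F] --> a -> g x @[x --> F] --> b ->
  mine (f x) (g x) @[x --> F] --> mine a b.
Proof.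
move=> fa gb.
by apply: (cvg_comp2 fa gb); exact: (@min_continuous _ (\bar R) (a, b)).
Qed.

Lemma cvge_bigmax {T I : Type} (F : set_system T) (FF : Filter F)
    (r : seq I) (f : I -> T -> \bar R) (l : I -> \bar R) :
  (forall i, f i x @[x --> F] --> l i) ->
  \big[maxe/-oo]_(i <- r) f i x @[x --> F] --> \big[maxe/-oo]_(i <- r) l i.
Proof.
move=> fl; elim: r => [|i r IHr].
  by under eq_fun do rewrite big_nil; rewrite big_nil; exact: cvg_cst.
under eq_fun do rewrite big_cons.
by rewrite big_cons; exact: cvge_max.
Qed.

Lemma cvge_bigmin {T I : Type} (F : set_system T) (FF : Filter F)
    (r : seq I) (f : I -> T -> \bar R) (l : I -> \bar R) :
  (forall i, f i x @[x --> F] --> l i) ->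
  \big[mine/+oo]_(i <- r) f i x @[x --> F] --> \big[mine/+oo]_(i <- r) l i.
Proof.
move=> fl; elim: r => [|i r IHr].
  by under eq_fun do rewrite big_nil; rewrite big_nil; exact: cvg_cst.
under eq_fun do rewrite big_cons.
by rewrite big_cons; exact: cvge_min.
Qed.

End UltraLimit.

(** * Continuous selections of affine functions, and cycle means *)

Section PiecewiseAffine.
Context {R : realType}.

(** An affine function changes sign only at its zero, so each new function cuts every piece there.
    Applied to differences, this yields pieces on which a finite family of affine functions keeps
    its order. *)
Lemma affine_sign_cover (ds : seq (R * R)) :
  exists pieces : seq (interval R),
    (forall x : R, exists2 I, I \in pieces & x \in I) /\
    (forall I, I \in pieces -> forall d, d \in ds -> {in I &, forall x y : R,
       Num.sg (d.1 * x + d.2)%R = Num.sg (d.1 * y + d.2)%R}).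
Proof.
elim: ds => [|d ds [pieces [cov sgn]]].
  by exists [:: `]-oo, +oo[%R]; split => [x|//]; exists `]-oo, +oo[%R; rewrite ?mem_head ?in_itv.
(* If [d.1 = 0] then [z] is a junk value, and cutting there is harmless. *)
pose z := (- d.2 / d.1)%R.
pose cuts : seq (interval R) := [:: `]-oo, z[; `[z, z]; `]z, +oo[]%R.
exists [seq Order.meet X Y | X <- pieces, Y <- cuts]; split.
  move=> x; have [I Ip xI] := cov x.
  have [J Jc xJ] : exists2 J, J \in cuts & x \in J.
    have [xz|xz|xz] := ltgtP x z.
    - by exists `]-oo, z[%R; [rewrite !inE eqxx|rewrite in_itv].
    - by exists `]z, +oo[%R; [rewrite !inE eqxx !orbT|rewrite in_itv /= xz].
    - by exists `[z, z]%R; [rewrite !inE eqxx !orbT|rewrite in_itv /= xz lexx].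
  exists (Order.meet I J); last by rewrite in_itvI xI.
  by apply/allpairsP; exists (I, J).
move=> _ /allpairsP[[I J] [/= Ip Jc ->]] e; rewrite inE => /predU1P[->|eds]; last first.
  by move=> x y; rewrite !in_itvI => /andP[xI _] /andP[yI _]; exact: (sgn I).
move=> x y; rewrite !in_itvI => /andP[_ xJ] /andP[_ yJ].
have [->|d1] := eqVneq d.1 0%R; first by rewrite !mul0r.
have dE u : (d.1 * u + d.2 = d.1 * (u - z))%R by rewrite /z; field.
rewrite !dE !sgrM; congr (_ * _)%R.
rewrite !inE in Jc; case/or3P: Jc xJ yJ => /eqP->; rewrite !in_itv /= ?andbT.
- by move=> xz yz; rewrite !ltr0_sg// subr_lt0.
- by move=> /le_anti <- /le_anti <-.
- by move=> xz yz; rewrite !gtr0_sg// subr_gt0.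
Qed.

(** On a piece where the affine functions keep their order, two of them either coincide or never
    meet, so a continuous selection cannot pass from one value to another. *)
Lemma continuous_selection_piecewise_affine (K : finType) (a b : K -> R) (s : R -> R) :
  continuous s -> (forall t, exists k, s t = a k * t + b k)%R -> piecewise_affine s.
Proof.
move=> s_cont sel.
pose f k t := (a k * t + b k)%R.
have [pieces [cov sgn]] := affine_sign_cover
  [seq ((a k.1 - a k.2)%R, (b k.1 - b k.2)%R) | k <- enum {: K * K}].
exists pieces; split => // I Ip.
have lt_tr k k' : {in I &, forall u w, f k u < f k' u -> f k w < f k' w}%R.
  move=> u w uI wI.
  have fE v : ((a k - a k') * v + (b k - b k') = f k v - f k' v)%R by rewrite /f; ring.
  have := sgn I Ip ((a k - a k')%R, (b k - b k')%R) _ u w uI wI.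
  rewrite /= !fE => H; rewrite -subr_lt0 -sgr_lt0 H ?sgr_lt0 ?subr_lt0//.
  by apply/mapP; exists (k, k'); rewrite ?mem_enum.
have le_tr k k' : {in I &, forall u w, f k u <= f k' u -> f k w <= f k' w}%R.
  by move=> u w uI wI; apply: contraTT; rewrite -!ltNge; exact: lt_tr.
have convex u w z : u \in I -> w \in I ->
    (Num.min u w <= z <= Num.max u w)%R -> z \in I.
  move=> uI wI; have II := @interval_is_interval R I.
  by case: (leP u w) => _; [exact: (II u w)|exact: (II w u)].
(* Otherwise [s] would cross the midpoint of [f k] and of its successor [f g]
   in the order of the values on [I], where no [f p] can be. *)
have nojump k k' x y : x \in I -> y \in I -> s x = f k x -> s y = f k' y ->
    ~ (f k x < f k' x)%R.
  move=> xI yI sx sy kk'.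
  pose g := [arg min_(g < k' | (f k x < f g x)%R) f g x]%O.
  have [kg gmin] : (f k x < f g x)%R /\
      forall p, (f k x < f p x)%R -> (f g x <= f p x)%R.
    by rewrite /g; case: arg_minP.
  pose mid z := ((f k z + f g z) / 2)%R.
  have [z + sz] : exists2 z, z \in `[Num.min x y, Num.max x y]%R & (s z - mid z = 0)%R.
    have kgy := lt_tr k g x y xI yI kg.
    have gk'y := le_tr g k' x y xI yI (gmin _ kk').
    have phix : (s x - mid x <= 0)%R by rewrite sx /mid; lra.
    have phiy : (0 <= s y - mid y)%R by rewrite sy /mid; lra.
    apply: (@IVT R (fun z => s z - mid z)%R).
    - by rewrite ge_min le_max lexx.
    - apply: continuous_subspaceT => u; apply: cvgB; first exact: s_cont.
      apply: cvgM; last exact: cvg_cst.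
      by apply: cvgD; (apply: cvgD; [apply: cvgM; [exact: cvg_cst|exact: cvg_id]|exact: cvg_cst]).
    - case: (leP x y) => _; rewrite ge_min le_max ?phix ?phiy ?orbT//.
  rewrite in_itv /= => zxy.
  have zI := convex _ _ _ xI yI zxy.
  have [p sp] := sel z; rewrite -/(f p z) in sp.
  have kgz := lt_tr k g x z xI zI kg.
  have [pk|kp] := leP (f p x) (f k x).
    by have := le_tr p k x z xI zI pk; move: sz; rewrite sp /mid; lra.
  by have := le_tr g p x z xI zI (gmin _ kp); move: sz; rewrite sp /mid; lra.
(* An empty piece accepts any coefficients. *)
have [[x0 x0I]|noI] := pselect (exists x, x \in I); last first.
  by exists 0%R, 0%R => x xI; case: noI; exists x.
have [k sk] := sel x0; exists (a k), (b k) => y yI.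
have [k' sk'] := sel y.
rewrite sk' -/(f k' y) -/(f k y); have [lt|lt|//] := ltgtP (f k y) (f k' y).
- by case: (nojump k k' x0 y) => //; exact: lt_tr _ _ y x0 yI x0I lt.
- by case: (nojump k' k y x0).
Qed.

Lemma nonexpansive_continuous (s : R -> R) :
  (forall t t', `|s t - s t'| <= `|t - t'|)%R -> continuous s.
Proof.
move=> s1 t; apply/cvgrPdist_lt => e e0; near=> t'.
apply: le_lt_trans (s1 _ _) _; near: t'.
exact: (@cvgrPdist_lt _ R^o _ _ _ id t).1 cvg_id e e0.
Unshelve. all: by end_near. Qed.

(** Summed along an orbit of [nx], the potentials [xi] telescope; on a cycle they cancel, and a
    cycle exists by the pigeonhole principle on the first [n.+1] iterates of [j0]. *)
Lemma cycle_mean (n : nat) (w xi : 'I_n -> R) (nx : 'I_n -> 'I_n)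
    (P : pred 'I_n) (s : R) (j0 : 'I_n) :
  P j0 -> (forall j, P j -> P (nx j) /\ (s + xi j = w j + xi (nx j))%R) ->
  exists j (L : 'I_n), (L.+1%:R * s = \sum_(l < L.+1) w (iter l nx j))%R.
Proof.
move=> Pj0 PH.
have Pit k : P (iter k nx j0) by elim: k => //= k /PH[].
have tel k p : (p%:R * s + xi (iter k nx j0) =
    \sum_(l < p) w (iter l nx (iter k nx j0)) + xi (iter p nx (iter k nx j0)))%R.
  elim: p => [|p IHp]; first by rewrite big_ord0 mul0r.
  rewrite big_ord_recr /=.
  have [_] := PH _ (Pit (p + k)%N); rewrite iterD => H.
  rewrite -natr1; lra.
pose g (k : 'I_n.+1) := iter k nx j0.
have /injectivePn[k [k' kk' gE]] : ~~ injectiveb g.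
  apply/negP => /injectiveP/leq_card.
  by rewrite !card_ord ltnn.
wlog : k k' kk' gE / (k < k')%N.
  move=> W; have [kk|kk|kk] := ltngtP k k'; first exact: (W k k').
  - by apply: (W k' k) => //; rewrite eq_sym.
  - by move/eqP: kk'; case; exact: val_inj.
(* The cycle has length [k' - k], between 1 and [n]; its predecessor [k' - k.+1] is what fits in
   ['I_n]. *)
move=> lt; have Ln : (k' - k.+1 < n)%N.
  by apply: leq_trans (ltn_ord k' : k' <= n)%N; rewrite ltn_subrL (leq_ltn_trans _ lt).
exists (g k), (Ordinal Ln) => /=.
have := tel k (k' - k.+1).+1; rewrite -iterD subnSK// subnK; last exact: ltnW.
by rewrite /g in gE *; rewrite gE => /addIr.
Qed.

End PiecewiseAffine.

(** * Spectral radius of a monotone homogeneous map, by vanishing discount *)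

Section SpectralRadius.
Context {R : realType} {n : nat}.
Implicit Types (x y : 'cV[\bar R]_n) (c : R).

Definition mp_le x y := forall j, x j ord0 <= y j ord0.

Definition mp_scale (a : R) x : 'cV[\bar R]_n := map_mx (fun t => a%:E * t) x.

Lemma mp_shiftE (b : \bar R) x j : mp_shift b x j ord0 = b + x j ord0.
Proof. by rewrite mxE. Qed.

Lemma mp_scaleE a x j : mp_scale a x j ord0 = a%:E * x j ord0.
Proof. by rewrite mxE. Qed.

Lemma mp_shiftD c c' x : mp_shift c%:E (mp_shift c'%:E x) = mp_shift (c + c')%:E x.
Proof. by apply/colP => j; rewrite !mp_shiftE EFinD addeA. Qed.

Lemma mp_scale_shift a c x :
  mp_scale a (mp_shift c%:E x) = mp_shift (a * c)%:E (mp_scale a x).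
Proof. by apply/colP => j; rewrite !(mp_shiftE, mp_scaleE) muleDr. Qed.

Lemma mp_scale_le a x y : (0 <= a)%R -> mp_le x y -> mp_le (mp_scale a x) (mp_scale a y).
Proof. by move=> a0 xy j; rewrite !mp_scaleE lee_wpmul2l// lee_fin. Qed.

Lemma mp_le_shift c x y : mp_le x y -> mp_le (mp_shift c%:E x) (mp_shift c%:E y).
Proof. by move=> xy j; rewrite !mp_shiftE leeD2l. Qed.

Lemma mp_le_trans y x z : mp_le x y -> mp_le y z -> mp_le x z.
Proof. by move=> xy yz j; exact: le_trans (yz j). Qed.

Definition mp_subeigen (h : 'cV[\bar R]_n -> 'cV[\bar R]_n) c y :=
  mp_le (mp_shift c%:E y) (h y).

Section Operator.
Variable h : 'cV[\bar R]_n -> 'cV[\bar R]_n.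
Hypothesis h_le : forall x y, mp_le x y -> mp_le (h x) (h y).
Hypothesis h_shift : forall c x, h (mp_shift c%:E x) = mp_shift c%:E (h x).
Variable C : R.
Hypothesis h0_le : forall j, (- C)%:E <= h (const_mx 0) j ord0 <= C%:E.

Let h0_ge j : (- C)%:E <= h (const_mx 0) j ord0.
Proof. by case/andP: (h0_le j). Qed.

Let h0_leC j : h (const_mx 0) j ord0 <= C%:E.
Proof. by case/andP: (h0_le j). Qed.

Let h_constE c j : h (const_mx c%:E) j ord0 = c%:E + h (const_mx 0) j ord0.
Proof.
rewrite -mp_shiftE -h_shift; congr (h _ _ _).
by apply/colP => i; rewrite !mxE adde0.
Qed.

(** The factor [a < 1] breaks homogeneity, so that large constants bound the solutions. The last
    clause is meant to survive the limit [a -> 1], where it bounds all subeigenvalues. *)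
Lemma discounted_eigenvector (a : R) (j1 : 'I_n) : (0 < a < 1)%R ->
  exists (mu : R) x j0,
    [/\ h (mp_scale a x) = mp_shift mu%:E x,
        mp_le x (const_mx 0), x j0 ord0 = 0,
        (`|mu| <= C)%R
      & forall c y j, mp_le y (const_mx 0) -> y j ord0 = 0 ->
          mp_subeigen h c y -> (c <= mu)%R].
Proof.
move=> /andP[a0 a1].
have b0 : (0 < 1 - a)%R by rewrite subr_gt0.
have a0' := ltW a0.
(* [K] is the fixed point of [t |-> a t + C]. Hence [w |-> h (a w)] sends the constant [K] below
   itself and the constant [- K] above itself. *)
pose K := (C / (1 - a))%R.
have KE : (a * K + C = K)%R by rewrite /K; field; rewrite gt_eqF.
(* [v] is Tarski's greatest fixed point of [w |-> h (a w)] below [K]. *)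
pose W := [set w | mp_le w (h (mp_scale a w)) /\ mp_le w (const_mx K%:E)].
pose v : 'cV[\bar R]_n := \col_j ereal_sup [set w j ord0 | w in W].
have Wv w : W w -> mp_le w v.
  by move=> Ww j; rewrite mxE; apply: ereal_sup_ubound; exists w.
have scaleK (k : R) : mp_scale a (const_mx k%:E) = const_mx (a * k)%:E.
  by apply/colP => j; rewrite !mxE.
have vK : mp_le v (const_mx K%:E).
  by move=> j; rewrite 2!mxE; apply: ge_ereal_sup => _ [w [_ wK] <-]; have := wK j; rewrite mxE.
have v_hv : mp_le v (h (mp_scale a v)).
  move=> j; rewrite [X in X <= _]mxE; apply: ge_ereal_sup => _ [w Ww <-].
  by apply: (le_trans (Ww.1 j)); apply: h_le; apply: mp_scale_le => //; exact: Wv.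
have Whv : W (h (mp_scale a v)).
  split; first by apply: h_le; exact: mp_scale_le.
  apply: mp_le_trans (h_le (mp_scale_le a0' vK)) _ => j.
  by rewrite scaleK h_constE mxE -{2}KE EFinD leeD2l.
have hv : h (mp_scale a v) = v.
  by apply/colP => j; apply/le_anti/andP; split; [exact: Wv|exact: v_hv].
have WK : W (const_mx (- K)%:E).
  have C0 : (0 <= C)%R by have := le_trans (h0_ge j1) (h0_leC j1); rewrite lee_fin; lra.
  split => j; last first.
    rewrite !mxE lee_fin; suff : (0 <= K)%R by lra.
    by rewrite divr_ge0// ltW.
  by rewrite scaleK h_constE mxE -{1}KE opprD -mulrN EFinD leeD2l.
have v_fin j : v j ord0 \is a fin_num.
  rewrite fin_numElt; apply/andP; split.
    by apply: lt_le_trans (Wv _ WK j); rewrite mxE ltNyr.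
  by apply: le_lt_trans (vK j) _; rewrite mxE ltry.
pose j0 := [arg max_(j > j1) v j ord0]%O.
have vj0 j : v j ord0 <= v j0 ord0 by rewrite /j0; case: arg_maxP => // i _; apply.
pose t := fine (v j0 ord0).
have tE : v j0 ord0 = t%:E by rewrite fineK.
have tK : (- K <= t <= K)%R.
  by rewrite -!lee_fin -tE; have := Wv _ WK j0; have := vK j0; rewrite !mxE => -> ->.
(* With [x = v - t], homogeneity gives [h (a x) = h (a v) - a t = v - a t = x + (1 - a) t]. *)
exists ((1 - a) * t)%R, (mp_shift (- t)%:E v), j0; split.
- rewrite mp_scale_shift h_shift hv mp_shiftD; congr (mp_shift _%:E _); ring.
- by move=> j; rewrite mp_shiftE [leRHS]mxE EFinN addeC sube_le0 -tE.
- by rewrite mp_shiftE EFinN addeC tE subee.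
- rewrite normrM gtr0_norm// mulrC -ler_pdivlMr// -/K ler_norml.
  by [].
- move=> c y j y0 yj cy.
  have cC : (c <= C)%R.
    rewrite -lee_fin; apply: (le_trans _ (h0_leC j)).
    by apply: le_trans (h_le y0 j); have := cy j; rewrite mp_shiftE yj adde0.
  (* The shift [k + y] lies in [W]: as [y <= a y] for [y <= 0], one has [k + y = a k + c + y <= a k
     + h y <= h (a (k + y))], and [c <= C] keeps it below [K]. Reading [k + y <= v] at [j] gives
     [k <= t]. *)
  pose k := (c / (1 - a))%R.
  have kE : (a * k + c = k)%R by rewrite /k; field; rewrite gt_eqF.
  have yay : mp_le y (mp_scale a y).
    move=> i; have := y0 i; rewrite mp_scaleE mxE; case: (y i ord0) => [r| |] //=.
    + by rewrite -EFinM !lee_fin => r0; nra.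
    + by move=> _; rewrite leNye.
  have Wk : W (mp_shift k%:E y).
    split.
      rewrite mp_scale_shift h_shift -{1}kE -mp_shiftD.
      by apply: mp_le_shift; apply: (mp_le_trans cy); exact: h_le.
    move=> i; rewrite mp_shiftE mxE -[leRHS]adde0; apply: leeD.
      by rewrite lee_fin ler_pM2r// invr_gt0.
    by have := y0 i; rewrite mxE.
  rewrite mulrC -ler_pdivrMr// -lee_fin -tE.
  by apply: le_trans (vj0 j); have := Wv _ Wk j; rewrite mp_shiftE yj adde0.
Qed.

Hypothesis h_cvg : forall (U : set_system nat) (FU : ProperFilter U)
    (x : nat -> 'cV[\bar R]_n) (l : 'cV[\bar R]_n),
  (forall j, x k j ord0 @[k --> U] --> l j ord0) ->
  forall j, h (x k) j ord0 @[k --> U] --> h l j ord0.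

Lemma spectral_radius_exists : (0 < n)%N ->
  exists s : R, is_spectral_radius h s%:E /\
    forall c y, Rmax_mx y -> y != const_mx -oo -> mp_subeigen h c y -> (c <= s)%R.
Proof.
move=> n0.
(* The shifted index makes [a k = 1 - 1 / (k + 2)]; unshifted, the first factor would be 0. *)
pose a k : R := (1 - harmonic k.+1)%R.
have a01 k : (0 < a k < 1)%R.
  rewrite /a subr_gt0 ltrBlDr ltrDl invr_gt0 ltr0n andbT.
  by rewrite invf_lt1 ?ltr0n// ltr1n.
have /choice[mu /choice[x /choice[j0 D]]] := fun k => discounted_eigenvector (Ordinal n0) (a01 k).
(* One ultrafilter finer than the filter at infinity makes [mu] and all coordinates of [x] converge
   at once, without extracting subsequences. *)
have [U [UU ooU]] := ultraFilterLemma (@eventually_filter).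
have UF : ProperFilter U by exact: ultra_proper.
have /choice[l' xl'] : forall j, exists b : \bar R, x k j ord0 @[k --> U] --> b.
  by move=> j; exact: ultra_cvg_ereal.
pose l : 'cV[\bar R]_n := \col_j l' j.
have xl j : x k j ord0 @[k --> U] --> l j ord0 by rewrite mxE; exact: xl'.
have [m mum] : exists b : \bar R, (mu k)%:E @[k --> U] --> b by exact: ultra_cvg_ereal.
have mC : (- C)%:E <= m <= C%:E.
  apply/andP; split.
    apply: (cvge_to_ge mum); apply: nearW => k.
    by rewrite lee_fin; have [_ _ _ + _] := D k; rewrite ler_norml => /andP[].
  apply: (cvge_to_le mum); apply: nearW => k.
  by rewrite lee_fin; have [_ _ _ + _] := D k; rewrite ler_norml => /andP[].
have mfin : m \is a fin_num.
  rewrite fin_numElt; case/andP: mC => Cm mC.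
  by rewrite (lt_le_trans _ Cm) ?ltNyr// (le_lt_trans mC) ?ltry.
have ak1 : (a k)%:E @[k --> U] --> 1%:E.
  apply: cvg_EFin; first exact: nearW.
  apply: (@cvg_trans _ (a k @[k --> \oo])); first by move=> A /= /ooU.
  suff : (1 - harmonic k.+1)%R @[k --> \oo] --> (1 - 0 : R)%R by rewrite subr0.
  apply: cvgB; first exact: cvg_cst.
  by have := @cvg_harmonic R; rewrite -cvg_shiftS.
have l_le0 j : l j ord0 <= 0.
  apply: (cvge_to_le (xl j)); apply: nearW => k.
  by have [_ /(_ j) + _ _ _] := D k; rewrite mxE.
have hl : mp_shift m l = h l.
  apply/colP => j; rewrite mp_shiftE.
  have hj : h (mp_scale (a k) (x k)) j ord0 @[k --> U] --> h l j ord0.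
    apply: h_cvg => // i; under eq_fun do rewrite mp_scaleE.
    (* The limit 1 of [a k] is real and nonzero, so the product converges even where [l] is -oo. *)
    by rewrite -(mul1e (l i ord0)); apply: cvgeM => //; rewrite mule_defE onee_eq0 abse1 /= andbF.
  have : (mu k)%:E + x k j ord0 @[k --> U] --> m + l j ord0.
    by apply: cvgeD => //; exact: fin_num_adde_defr.
  have -> : (fun k => (mu k)%:E + x k j ord0) = (fun k => h (mp_scale (a k) (x k)) j ord0).
    by apply/funext => k; have [-> _ _ _ _] := D k; rewrite mp_shiftE.
  by move=> /(cvg_unique (@ereal_hausdorff R)); apply.
have l_neq : l != const_mx -oo.
  apply/eqP => lNy.
  (* Each [x k] has maximum 0, and a finite maximum passes to the limit, so [l] cannot be -oo
     everywhere. *)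
  have : \big[maxe/-oo]_j x k j ord0 @[k --> U] --> \big[maxe/-oo]_j l j ord0.
    exact: cvge_bigmax.
  have -> : (fun k => \big[maxe/-oo]_j x k j ord0) = cst 0.
    apply/funext => k; have [_ x0 xj _ _] := D k; apply/le_anti/andP; split.
      by apply: bigmax_le => [|j _]; [rewrite leNye|have := x0 j; rewrite mxE].
    by rewrite -[leLHS]xj; exact: (le_bigmax _ (fun j => x k j ord0)).
  have -> : \big[maxe/-oo]_j l j ord0 = -oo.
    by apply: bigmax_eq_id => j _; rewrite lNy mxE.
  have /(cvg_unique (@ereal_hausdorff R)) H : cst (0 : \bar R) @ U --> 0 by exact: cvg_cst.
  by move=> /H.
have ub c y : Rmax_mx y -> y != const_mx -oo -> mp_subeigen h c y -> (c <= fine m)%R.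
  move=> yR yN cy.
  (* Subtracting the largest coordinate of [y] gives it maximum 0, as the comparison with each
     [mu k] requires. *)
  pose i := [arg max_(j > Ordinal n0) y j ord0]%O.
  have yi j : y j ord0 <= y i ord0 by rewrite /i; case: arg_maxP => // i' _; apply.
  have yfin : y i ord0 \is a fin_num.
    rewrite fin_numE yR andbT; apply: contra yN => /eqP yiN.
    apply/eqP/colP => j; rewrite mxE; apply/eqP.
    by rewrite -leeNy_eq -yiN.
  rewrite -lee_fin fineK//; apply: (cvge_to_ge mum); apply: nearW => k.
  have [_ _ _ _ /(_ c (mp_shift (- fine (y i ord0))%:E y) i)] := D k.
  rewrite lee_fin; apply.
  - by move=> j; rewrite mp_shiftE mxE EFinN fineK// addeC sube_le0.
  - by rewrite mp_shiftE EFinN fineK// addeC subee.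
  - rewrite /mp_subeigen h_shift mp_shiftD addrC -mp_shiftD.
    exact: mp_le_shift.
exists (fine m); split=> //; rewrite fineK//; split.
  split; first by case: (m) mfin.
  exists l; split => // i j; rewrite (ord1 j).
  by rewrite /Rmax /= -ltey (le_lt_trans (l_le0 i)) ?ltry.
move=> [c| |] [cR [y [yR yN cy]]] //; last by rewrite leNye.
rewrite -(fineK mfin) lee_fin; apply: (ub c y) => //.
by rewrite /mp_subeigen cy => j.
Qed.

End Operator.
End SpectralRadius.

(** * Monotonicity, continuity, finiteness and attained choices for [h_map] *)

Section GameOperator.
Context {R : realType} {m n : nat}.
Implicit Types (A B : 'M[\bar R]_(m, n)) (x y : 'cV[\bar R]_n).

(** The two additions differ only on opposite infinities, so a real summand gives access to the
    theory of the usual one. *)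
Lemma dadde_EFinl (r : R) (t : \bar R) : (r%:E + t)%dE = (r%:E + t)%E.
Proof. by case: t. Qed.

Lemma EFin_adde_minr (r : R) (s t : \bar R) :
  r%:E + mine s t = mine (r%:E + s) (r%:E + t).
Proof. by rewrite -!dadde_EFinl DualAddTheoryRealDomain.dadde_minr. Qed.

Variant Rmax_spec (a : \bar R) : \bar R -> Prop :=
  | RmaxNy of a = -oo : Rmax_spec a -oo
  | RmaxFin (r : R) of a = r%:E : Rmax_spec a r%:E.

Lemma RmaxP (a : \bar R) : Rmax a -> Rmax_spec a a.
Proof. by case: a => [r| |] //= _; constructor. Qed.

Lemma mp_mulE A x i : mp_mul A x i ord0 = \big[maxe/-oo]_j (A i j + x j ord0).
Proof. by rewrite mxE. Qed.

Lemma mp_residualE A (y : 'cV[\bar R]_m) j :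
  mp_residual A y j ord0 = \big[mine/+oo]_i (- A i j + y i ord0)%dE.
Proof. by rewrite mxE. Qed.

Lemma mp_mul_le A x y : mp_le x y -> mp_le (mp_mul A x) (mp_mul A y).
Proof.
move=> xy i; rewrite !mp_mulE; apply: le_bigmax2 => j _; exact: leeD2l.
Qed.

Lemma mp_residual_le A (x y : 'cV[\bar R]_m) : Rmax_mx A ->
  mp_le x y -> mp_le (mp_residual A x) (mp_residual A y).
Proof.
move=> hA xy j; rewrite !mp_residualE; apply: le_bigmin2 => i _.
case: (RmaxP (hA i j)) => [_|r _] /=; first by rewrite !DualAddTheoryNumDomain.daddye.
by rewrite !dadde_EFinl leeD2l.
Qed.

Lemma mp_mul_shift A (c : R) x :
  mp_mul A (mp_shift c%:E x) = mp_shift c%:E (mp_mul A x).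
Proof.
apply/colP => i; rewrite mp_shiftE !mp_mulE.
have M : {morph (fun t => c%:E + t) : s t / maxe s t} by move=> s t; rewrite adde_maxr.
rewrite [RHS](big_morph _ M (erefl : c%:E + -oo = -oo)).
by apply: eq_bigr => j _; rewrite mp_shiftE addeCA.
Qed.

Lemma mp_residual_shift A (c : R) (y : 'cV[\bar R]_m) : Rmax_mx A ->
  mp_residual A (mp_shift c%:E y) = mp_shift c%:E (mp_residual A y).
Proof.
move=> hA; apply/colP => j; rewrite mp_shiftE !mp_residualE.
have M : {morph (fun t => c%:E + t) : s t / mine s t} by move=> s t; rewrite EFin_adde_minr.
rewrite [RHS](big_morph _ M (erefl : c%:E + +oo = +oo)).
apply: eq_bigr => i _; rewrite mp_shiftE.
case: (RmaxP (hA i j)) => [_|r _] /=; first by rewrite !DualAddTheoryNumDomain.daddye.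
by rewrite !dadde_EFinl addeCA.
Qed.

(** A -oo entry contributes a constant term and a real entry a translation; both are continuous on
    all of [\bar R]. The same holds for the residual, whose constant is +oo. *)
Lemma mp_mul_cvg {T : Type} A (U : set_system T) (FU : Filter U)
    (x : T -> 'cV[\bar R]_n) (l : 'cV[\bar R]_n) : Rmax_mx A ->
  (forall j, x k j ord0 @[k --> U] --> l j ord0) ->
  forall i, mp_mul A (x k) i ord0 @[k --> U] --> mp_mul A l i ord0.
Proof.
move=> hA xl i; rewrite mp_mulE; under eq_fun do rewrite mp_mulE.
apply: cvge_bigmax => j.
case: (RmaxP (hA i j)) => [_|r _] /=; last first.
  by apply: cvgeD => //; exact: cvg_cst.
rewrite addNye; under eq_fun do rewrite addNye; exact: cvg_cst.
Qed.

Lemma mp_residual_cvg {T : Type} A (U : set_system T) (FU : Filter U)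
    (y : T -> 'cV[\bar R]_m) (l : 'cV[\bar R]_m) : Rmax_mx A ->
  (forall i, y k i ord0 @[k --> U] --> l i ord0) ->
  forall j, mp_residual A (y k) j ord0 @[k --> U] --> mp_residual A l j ord0.
Proof.
move=> hA yl j; rewrite mp_residualE; under eq_fun do rewrite mp_residualE.
apply: cvge_bigmin => i.
case: (RmaxP (hA i j)) => [_|r _] /=; first exact: cvg_cst.
rewrite dadde_EFinl; under eq_fun do rewrite dadde_EFinl.
by apply: cvgeD => //; exact: cvg_cst.
Qed.

Lemma mp_mul_attained A x i : Rmax_mx A -> Rmax_mx x ->
  mp_mul A x i ord0 \is a fin_num ->
  exists j, [/\ A i j \is a fin_num, x j ord0 \is a fin_num &
    mp_mul A x i ord0 = A i j + x j ord0].
Proof.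
move=> hA hx; rewrite mp_mulE => fin.
(* An empty maximum is -oo, which [fin] excludes. *)
have [[j _]|noj] := pselect (exists j : 'I_n, True); last first.
  by move: fin; rewrite big1 // => j; case: noj; exists j.
have [//|? _|k _ Ek] := @eq_bigmax _ _ _ -oo j xpredT (fun j => A i j + x j ord0).
  exact: leNye.
exists k; split; rewrite -?Ek//.
  by move: fin; rewrite Ek; case: (RmaxP (hA i k)) => //; rewrite addNye.
by move: fin; rewrite Ek; case: (RmaxP (hx k ord0)) => //; rewrite addeNy.
Qed.

Lemma mp_residual_attained A (y : 'cV[\bar R]_m) j : Rmax_mx A ->
  mp_residual A y j ord0 \is a fin_num ->
  exists i, [/\ A i j \is a fin_num, y i ord0 \is a fin_num &
    mp_residual A y j ord0 = - A i j + y i ord0].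
Proof.
move=> hA; rewrite mp_residualE => fin.
have [[i _]|noi] := pselect (exists i : 'I_m, True); last first.
  by move: fin; rewrite big1 // => i; case: noi; exists i.
have [//|? _|k _ Ek] := @eq_bigmin _ _ _ +oo i xpredT (fun i => (- A i j + y i ord0)%dE).
  exact: leey.
move: fin; exists k; rewrite Ek in fin *.
case: (RmaxP (hA k j)) fin => [_|r _] /=; first by rewrite DualAddTheoryNumDomain.daddye.
by rewrite dadde_EFinl; case: (y k ord0).
Qed.

Lemma mp_mul0_fin A i : Rmax_mx A -> row i A != const_mx -oo ->
  mp_mul A (const_mx 0) i ord0 \is a fin_num.
Proof.
move=> hA Ai; rewrite mp_mulE fin_numE; apply/andP; split.
  apply: contra Ai => /eqP E; apply/eqP/rowP => j; rewrite !mxE; apply/eqP.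
  rewrite -leeNy_eq -E.
  by apply: le_trans (le_bigmax _ _ j); rewrite mxE adde0.
rewrite -ltey; apply: bigmax_lt => // j _; rewrite mxE adde0.
by case: (RmaxP (hA i j)) => // r _; rewrite ltry.
Qed.

Lemma mp_residual_neqNy A (y : 'cV[\bar R]_m) j : Rmax_mx A ->
  (forall i, y i ord0 \is a fin_num) -> -oo < mp_residual A y j ord0.
Proof.
move=> hA hy; rewrite mp_residualE; apply: lt_bigmin => // i _.
case: (RmaxP (hA i j)) => [_|r _] //=.
by rewrite dadde_EFinl; case: (y i ord0) (hy i) => // t _; rewrite -EFinD ltNyr.
Qed.

Lemma mp_residual_eqy A (y : 'cV[\bar R]_m) j : Rmax_mx A ->
  (forall i, y i ord0 \is a fin_num) -> mp_residual A y j ord0 = +oo ->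
  col j A = const_mx -oo.
Proof.
move=> hA hy Ey; apply/colP => i; rewrite !mxE.
case: (RmaxP (hA i j)) => [//|r Aij].
have : mp_residual A y j ord0 <= (- A i j + y i ord0)%dE.
  by rewrite mp_residualE; exact: (bigmin_le _ i (fun i => (- A i j + y i ord0)%dE)).
by rewrite Ey Aij /= dadde_EFinl; case: (y i ord0) (hy i).
Qed.

Variables A B : 'M[\bar R]_(m, n).
Hypotheses (hA : Rmax_mx A) (hB : Rmax_mx B).

Lemma h_mapE lam x j : h_map A B lam x j ord0 =
  mine (lam%:E + mp_residual A (mp_mul B x) j ord0)
       (- lam%:E + mp_residual B (mp_mul A x) j ord0).
Proof. by rewrite !mxE. Qed.

Lemma h_map_le lam x y : mp_le x y -> mp_le (h_map A B lam x) (h_map A B lam y).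
Proof.
move=> xy j; rewrite !h_mapE; apply: le_min2; apply: leeD2l;
  apply: mp_residual_le => //; exact: mp_mul_le.
Qed.

Lemma h_map_shift lam (c : R) x :
  h_map A B lam (mp_shift c%:E x) = mp_shift c%:E (h_map A B lam x).
Proof.
apply/colP => j; rewrite mp_shiftE !h_mapE !mp_mul_shift !mp_residual_shift//.
by rewrite EFin_adde_minr !mp_shiftE; congr mine; rewrite addeCA.
Qed.

Lemma h_map_cvg lam {T : Type} (U : set_system T) (FU : Filter U)
    (x : T -> 'cV[\bar R]_n) (l : 'cV[\bar R]_n) :
  (forall j, x k j ord0 @[k --> U] --> l j ord0) ->
  forall j, h_map A B lam (x k) j ord0 @[k --> U] --> h_map A B lam l j ord0.
Proof.
move=> xl j; rewrite h_mapE; under eq_fun do rewrite h_mapE.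
apply: cvge_min; apply: cvgeD; rewrite ?fin_num_adde_defr ?fin_numN//;
  try exact: cvg_cst;
  by apply: mp_residual_cvg => // i; exact: mp_mul_cvg.
Qed.

Hypothesis hm : (0 < m)%N.
Hypothesis hrowA : forall i, row i A != const_mx -oo.
Hypothesis hrowB : forall i, row i B != const_mx -oo.
Hypothesis hcol : forall j, ~ (col j A = const_mx -oo /\ col j B = const_mx -oo).

(** The row hypotheses make the images of 0 under [A] and [B] real. The residual of a real vector is
    never -oo, and is +oo only at a -oo column, which [hcol] forbids for both matrices at once. *)
Lemma h_map0_fin lam j : h_map A B lam (const_mx 0) j ord0 \is a fin_num.
Proof.
have A0 i : mp_mul A (const_mx 0) i ord0 \is a fin_num by exact: mp_mul0_fin.
have B0 i : mp_mul B (const_mx 0) i ord0 \is a fin_num by exact: mp_mul0_fin.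
have := mp_residual_eqy (j := j) hA B0; have := mp_residual_neqNy j hA B0.
have := mp_residual_eqy (j := j) hB A0; have := mp_residual_neqNy j hB A0.
rewrite h_mapE.
case: (mp_residual A _ _ _) => [a| |]; case: (mp_residual B _ _ _) => [b| |];
  rewrite ?ltxx //.
- by move=> *; rewrite -!EFinD; case: leP.
- by move=> *; rewrite addey// miney.
- by move=> _ /(_ erefl) Bj _ /(_ erefl) Aj; case: (@hcol j).
Qed.

(* A choice [(b, i, k)] at coordinate [j] selects, in the formula for
   [h_map A B lam x j], the left ([b = true]) or right residual, the row [i]
   attaining its minimum and the column [k] attaining the maximum in row [i];
   [k] is the next coordinate. *)
Definition move_sign (d : bool * 'I_m * 'I_n) : R := if d.1.1 then 1%R else (-1)%R.

Definition move_weight (j : 'I_n) (d : bool * 'I_m * 'I_n) : R :=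
  (if d.1.1 then fine (B d.1.2 d.2) - fine (A d.1.2 j)
  else fine (A d.1.2 d.2) - fine (B d.1.2 j))%R.

Lemma h_map_attained lam x j : Rmax_mx x -> h_map A B lam x j ord0 \is a fin_num ->
  exists d : bool * 'I_m * 'I_n, x d.2 ord0 \is a fin_num /\
    h_map A B lam x j ord0 =
    (move_sign d * lam + move_weight j d + fine (x d.2 ord0))%:E.
Proof.
move=> hx; rewrite h_mapE.
have [_|_] := leP (lam%:E + mp_residual A (mp_mul B x) j ord0)
                  (- lam%:E + mp_residual B (mp_mul A x) j ord0).
  rewrite fin_numD => /andP[_ /(mp_residual_attained hA)[i [Aij Bi ->]]].
  have [k [Bik xk ->]] := mp_mul_attained hB hx Bi.
  exists (true, i, k); split => //; rewrite /move_sign /move_weight /=.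
  rewrite -[in LHS](fineK Aij) -[in LHS](fineK Bik) -[in LHS](fineK xk).
  by rewrite -EFinN -!EFinD; congr EFin; ring.
rewrite fin_numD => /andP[_ /(mp_residual_attained hB)[i [Bij Ai ->]]].
have [k [Aik xk ->]] := mp_mul_attained hA hx Ai.
exists (false, i, k); split => //; rewrite /move_sign /move_weight /=.
rewrite -[in LHS](fineK Bij) -[in LHS](fineK Aik) -[in LHS](fineK xk).
by rewrite -!EFinN -!EFinD; congr EFin; ring.
Qed.

(** The index is a choice at every coordinate, a start, and a length minus one. The orbit need not
    close up: what matters is that this finite family contains all cycle means. *)
Definition cycle_average (w : 'I_n -> bool * 'I_m * 'I_n -> R)
    (p : {ffun 'I_n -> bool * 'I_m * 'I_n} * 'I_n * 'I_n) : R :=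
  (\sum_(l < p.2.+1)
     let j := iter l (fun j => (p.1.1 j).2) p.1.2 in w j (p.1.1 j)) / p.2.+1%:R.

Lemma h_map_eigenvalue_affine lam (s : R) x : Rmax_mx x -> x != const_mx -oo ->
  mp_shift s%:E x = h_map A B lam x ->
  exists p, (s = cycle_average (fun=> move_sign) p * lam + cycle_average move_weight p)%R.
Proof.
move=> hx x0 sx.
have [j0 xj0] : exists j0, x j0 ord0 \is a fin_num.
  apply: contrapT => no; move/eqP: x0; apply; apply/colP => j; rewrite mxE.
  by case: (RmaxP (hx j ord0)) => [//|r xj]; case: no; exists j; rewrite xj.
have /choice[g gP] : forall j, exists d : bool * 'I_m * 'I_n, x j ord0 \is a fin_num ->
    x d.2 ord0 \is a fin_num /\
    (s + fine (x j ord0) = move_sign d * lam + move_weight j d + fine (x d.2 ord0))%R.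
  move=> j; have [xj|xj] := boolP (x j ord0 \is a fin_num); last first.
    (* At a -oo coordinate the choice is arbitrary, since the cycle visits finite coordinates
       only. *)
    by exists (true, Ordinal hm, j).
  have hj : s%:E + x j ord0 = h_map A B lam x j ord0 by rewrite -sx mp_shiftE.
  have [|d [xd hd]] := h_map_attained (lam := lam) (j := j) hx.
    by rewrite -hj fin_numD xj.
  exists d => _; split => //; apply: EFin_inj.
  by rewrite -hd -hj EFinD fineK.
have [j [L EL]] := cycle_mean (w := fun j => (move_sign (g j) * lam + move_weight j (g j))%R)
  (xi := fun j => fine (x j ord0)) (nx := fun j => (g j).2)
  (P := fun j => x j ord0 \is a fin_num) (s := s) xj0 gP.
(* The weights along the cycle are affine in [lam], so their mean splits into a slope and an
   intercept. *)
exists ([ffun j => g j], j, L); rewrite /cycle_average /= mulrAC -mulrDl mulr_suml -big_split /=.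
apply: (mulfI (_ : L.+1%:R != 0 :> R)%R); first by rewrite pnatr_eq0.
rewrite EL mulrCA divff ?pnatr_eq0// mulr1; apply: eq_bigr => l _.
have it : forall l, iter l (fun j => ([ffun j0 => g j0] j).2) j = iter l (fun j => (g j).2) j.
  by move=> k; apply: eq_iter => i; rewrite ffunE.
by rewrite it ffunE.
Qed.

End GameOperator.

(** * The spectral function *)

Theorem corollary1 (R : realType) (m n : nat) (hm : (0 < m)%N) (hn : (0 < n)%N)
    (A B : 'M[\bar R]_(m, n))
    (hA : Rmax_mx A) (hB : Rmax_mx B)
    (hrowA : forall i, row i A != const_mx -oo)
    (hrowB : forall i, row i B != const_mx -oo)
    (hcol : forall j, ~ (col j A = const_mx -oo /\ col j B = const_mx -oo)) :
  exists s : R -> R,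
    [/\ is_spectral_function A B (fun lam => (s lam)%:E),
        piecewise_affine s
      & lipschitz s].
Proof.
pose H lam := h_map A B lam.
have rad lam : exists s : R, is_spectral_radius (H lam) s%:E /\
    forall c y, Rmax_mx y -> y != const_mx -oo -> mp_subeigen (H lam) c y -> (c <= s)%R.
  pose C := (\sum_j `|fine (H lam (const_mx 0) j ord0)|)%R.
  apply: (@spectral_radius_exists _ _ _ _ _ C) => //.
  - by move=> x y; exact: h_map_le.
  - by move=> c x; exact: h_map_shift.
  - move=> j; rewrite -(fineK (h_map0_fin hA hB hrowA hrowB hcol lam j)) !lee_fin -ler_norml.
    by rewrite /C (bigD1 j)//= lerDl sumr_ge0.
  - by move=> U FU x l; exact: h_map_cvg.
have /choice[s sP] := rad.
(* An eigenvector at [t] is a subeigenvector at [t'] for [s t - |t - t'|], since each of the two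
   terms of [h_map] drops by at most [|t - t'|]. *)
have s_sub t t' : (s t - `|t - t'| <= s t')%R.
  have [[_ [x [xR x0 sx]]] _] := (sP t).1.
  apply: ((sP t').2 _ x) => // j; rewrite mp_shiftE.
  have -> : (s t - `|t - t'|)%:E + x j ord0 = (- `|t - t'|)%:E + H t x j ord0.
    by rewrite -sx mp_shiftE addeA -EFinD (addrC (s t)).
  have t1 : (t - `|t - t'| <= t')%R by have := ler_norm (t - t')%R; lra.
  have t2 : (- t - `|t - t'| <= - t')%R by have := ler_norm (t' - t)%R; rewrite distrC; lra.
  rewrite !h_mapE EFin_adde_minr; apply: le_min2; rewrite addeA; apply: leeD2r.
    by rewrite -EFinD lee_fin addrC.
  by rewrite -!EFinN -EFinD lee_fin addrC.
have s1 t t' : (`|s t - s t'| <= `|t - t'|)%R.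
  have := s_sub t t'; have := s_sub t' t; rewrite (distrC t').
  by rewrite ler_distl => *; apply/andP; split; lra.
exists s; split.
- by move=> lam; exact: (sP lam).1.
- apply: (continuous_selection_piecewise_affine (K := _)
    (a := cycle_average (fun=> move_sign)) (b := cycle_average (move_weight A B))).
    exact: nonexpansive_continuous.
  move=> t; have [[_ [x [xR x0 sx]]] _] := (sP t).1.
  exact: h_map_eigenvalue_affine sx.
(* The pair of zeros witnesses that the domain is inhabited, hence that its filter is proper. *)
- apply: (@klipschitzW _ _ _ 1%R); first exact: (@globally_properfilter _ _ (0%R, 0%R)).
  move=> -[t t'] _ /=.
  by rewrite mul1r; exact: s1.
Qed.
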